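(* Let $A$ be a commutative ring, $\mathfrak{a}$ an ideal of $A$, $Z$ a set, and $M$ an $A$-module whose $\mathfrak{a}$-adic completion $\widehat{M}$ is $\mathfrak{a}$-adically complete. Then the homomorphism $$\operatorname{F}_{\mathrm{fin}}(Z, M) \to \operatorname{F}_{\mathrm{dec}}(Z, \widehat{M}), \quad f \mapsto \tau_M \circ f,$$ makes $\operatorname{F}_{\mathrm{dec}}(Z, \widehat{M})$ into an $\mathfrak{a}$-adic completion of $\operatorname{F}_{\mathrm{fin}}(Z, M)$. More precisely, there is an isomorphism of $A$-modules $$\operatorname{F}_{\mathrm{dec}}(Z, \widehat{M}) \cong \Lambda_{\mathfrak{a}} \operatorname{F}_{\mathrm{fin}}(Z, M)$$ that commutes with the homomorphisms from $\operatorname{F}_{\mathrm{fin}}(Z, M)$, and is functorial in $M$ (among $A$-modules whose $\mathfrak{a}$-adic completion is $\mathfrak{a}$-adically complete).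
   Context: For $i \geq 0$ write $A_i := A/\mathfrak{a}^{i+1}$. For an $A$-module $N$, its $\mathfrak{a}$-adic completion is $\Lambda_{\mathfrak{a}} N := \widehat{N} := \varprojlim_i (A_i \otimes_A N)$, with canonical homomorphism $\tau_N : N \to \widehat{N}$. $N$ is $\mathfrak{a}$-adically separated (resp. complete) if $\tau_N$ is injective (resp. bijective). $\operatorname{F}_{\mathrm{fin}}(Z, N)$ is the $A$-module of all functions $Z \to N$ with finite support. If $N$ is $\mathfrak{a}$-adically separated, put $\operatorname{ord}_{\mathfrak{a}}(n) := \sup\{ i \in \mathbb{N} \mid n \in \mathfrak{a}^i N\} \in \mathbb{N}\cup\{\infty\}$ for $n \in N$; a function $f : Z \to N$ is decaying if for every $i \in \mathbb{N}$ the set $\{ z \in Z \mid \operatorname{ord}_{\mathfrak{a}}(f(z)) \leq i\}$ is finite, and $\operatorname{F}_{\mathrm{dec}}(Z, N)$ is the $A$-module (under pointwise operations) of all decaying functions $Z \to N$. *)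

(* Defs.v *)
From HB Require Import structures.
From mathcomp Require Import all_boot all_order all_algebra.
From mathcomp Require Import all_classical.
From mathcomp Require Import constructive_ereal ereal.

Set Implicit Arguments.
Unset Strict Implicit.
Unset Printing Implicit Defensive.

Import Order.TTheory GRing.Theory Num.Theory.

Local Open Scope classical_set_scope.
Local Open Scope ring_scope.
Local Open Scope quotient_scope.

Definition regmod (A : comPzRingType) : lmodType A := A^o.

(* By classical logic every subset is a boolean predicate, so submodClosed V *)
(* ranges over all submodules of V. The unit ideal is allowed, contrary to what *)
(* happens with the idealr structure of ring_quotient. *)
Notation ideal A := (submodClosed (regmod A)).

Section Span.
Context {A : comPzRingType} {V : lmodType A}.
Implicit Types S : set V.

Definition span S : {pred V} :=
  fun v => `[< smallest (fun B : set V => submod_closed [in B]) S v >].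

Lemma sub_span S v : S v -> v \in span S.
Proof. by move=> Sv; apply/asboolP => B [_]; apply. Qed.

Lemma span_sub S (B : {pred V}) :
  submod_closed B -> (forall v, S v -> v \in B) -> {subset span S <= B}.
Proof.
move=> [B0 Blin] SB v /asboolP /(_ [set` B]).
apply; split => //; split; first exact/mem_set.
by move=> r x y /set_mem Bx /set_mem By; apply/mem_set; exact: Blin.
Qed.

Lemma span_submod S : submod_closed (span S).
Proof.
split; first by apply/asboolP => B [[/set_mem]].
move=> r x y /asboolP Sx /asboolP Sy; apply/asboolP => B SB.
have [[_ Blin] _] := SB.
by apply/set_mem/Blin; apply/mem_set; [exact: Sx|exact: Sy].
Qed.

HB.instance Definition _ S :=
  GRing.isSubmodClosed.Build A V (span S) (span_submod S).

End Span.

Section QuotientModule.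
Context {A : comPzRingType} {V : lmodType A}.

(* A copy of I that also carries the zmodClosed structure asked for by *)
(* Quotient.quot, as a variable of type submodClosed V does not provide it. *)
Definition submod_mem (I : submodClosed V) : {pred V} := [in I].

HB.instance Definition _ (I : submodClosed V) :=
  GRing.isSubmodClosed.Build A V (submod_mem I) (submodClosedP I).

Definition modquot (I : submodClosed V) : Type := Quotient.quot (submod_mem I).

Variable I : submodClosed V.

HB.instance Definition _ := Choice.on (modquot I).
HB.instance Definition _ := GRing.Zmodule.on (modquot I).

Definition mpi (v : V) : modquot I := \pi_(Quotient.quot (submod_mem I)) v.
Definition mrepr (x : modquot I) : V := repr (x : Quotient.quot (submod_mem I)).

Lemma mreprK : cancel mrepr mpi.
Proof. exact: reprK. Qed.

Lemma mpi_eq v w : (mpi v == mpi w) = (v - w \in I).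
Proof. exact: (esym (Quotient.idealrBE (submod_mem I) v w)). Qed.

Lemma mpiB v w : mpi (v - w) = mpi v - mpi w.
Proof. exact: raddfB. Qed.

Lemma mpiD v w : mpi (v + w) = mpi v + mpi w.
Proof. exact: raddfD. Qed.

Lemma mrepr_mpi v : mrepr (mpi v) - v \in I.
Proof. by rewrite -mpi_eq mreprK. Qed.

Definition modquot_scale (r : A) (x : modquot I) := mpi (r *: mrepr x).

Lemma mpiZ r v : mpi (r *: v) = modquot_scale r (mpi v).
Proof.
by apply/eqP; rewrite eq_sym mpi_eq -scalerBr rpredZ // mrepr_mpi.
Qed.

Lemma modquot_scaleA r s x :
  modquot_scale r (modquot_scale s x) = modquot_scale (r * s) x.
Proof. by rewrite -[x]mreprK -!mpiZ scalerA. Qed.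

Lemma modquot_scale1 : left_id 1 modquot_scale.
Proof. by move=> x; rewrite -[x]mreprK -!mpiZ scale1r. Qed.

Lemma modquot_scaleDr : right_distributive modquot_scale +%R.
Proof.
move=> r x y; rewrite -[x]mreprK -[y]mreprK -mpiD -!mpiZ -mpiD.
by rewrite scalerDr.
Qed.

Lemma modquot_scaleDl x : {morph modquot_scale^~ x : r s / r + s}.
Proof. by move=> r s; rewrite -[x]mreprK -!mpiZ -mpiD scalerDl. Qed.

HB.instance Definition _ := GRing.Zmodule_isLmodule.Build A (modquot I)
  modquot_scaleA modquot_scale1 modquot_scaleDr modquot_scaleDl.

Lemma mpi_linear : linear mpi.
Proof. by move=> r v w; rewrite mpiD mpiZ. Qed.

HB.instance Definition _ :=
  GRing.isLinear.Build A V (modquot I) *:%R mpi mpi_linear.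

End QuotientModule.

Arguments mpi {A V} I v.

Section FiniteSupport.
Context {A : comPzRingType}.
Variables (Z : Type) (V : lmodType A).

Definition fin_supp : pred (Z -> V) :=
  fun f => `[< finite_set [set z | f z != 0] >].

Lemma fin_supp_submod : submod_closed fin_supp.
Proof.
split=> [|r f g].
  apply/asboolP; rewrite (_ : mkset _ = set0) //.
  by apply/seteqP; split => z //=; rewrite eqxx.
move=> /asboolP ff /asboolP fg; apply/asboolP.
apply: (@sub_finite_set _ _ ([set z | f z != 0] `|` [set z | g z != 0]));
  last by rewrite finite_setU.
move=> z /=; rewrite -[(r *: f + g) z]/(r *: f z + g z).
by have [->|] := eqVneq (f z) 0; [rewrite scaler0 add0r; right|left].
Qed.

HB.instance Definition _ :=
  GRing.isSubmodClosed.Build A (Z -> V) fin_supp fin_supp_submod.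

Record Ffin := MkFfin { ffin_fun :> Z -> V; _ : ffin_fun \in fin_supp }.

HB.instance Definition _ := [isSub for ffin_fun].
HB.instance Definition _ := [Choice of Ffin by <:].
HB.instance Definition _ := [SubChoice_isSubLmodule of Ffin by <:].

Lemma ffinP (f : Ffin) : finite_set [set z | f z != 0].
Proof. exact/asboolP/(valP f). Qed.

Lemma ffin_linearE (r : A) (f g : Ffin) z : (r *: f + g) z = r *: f z + g z.
Proof. by []. Qed.

Lemma ffin_eq (f g : Ffin) : (forall z, f z = g z) -> f = g.
Proof. by move=> fg; apply/val_inj/funext. Qed.

End FiniteSupport.

Arguments fin_supp {A} Z V f.

Section FiniteSupportMap.
Context {A : comPzRingType}.
Variables (Z : Type) (V W : lmodType A) (g : {linear V -> W}).

Lemma ffin_map_subproof (f : Ffin Z V) : (g \o f) \in fin_supp Z W.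
Proof.
apply/asboolP; apply: (sub_finite_set _ (ffinP f)) => z /=.
by apply: contraNneq => ->; rewrite linear0.
Qed.

Definition ffin_map (f : Ffin Z V) : Ffin Z W := MkFfin (ffin_map_subproof f).

Lemma ffin_map_linear : linear ffin_map.
Proof. by move=> r f h; apply: ffin_eq => z; rewrite /= linearP. Qed.

HB.instance Definition _ := GRing.isLinear.Build A
  (Ffin Z V) (Ffin Z W) *:%R ffin_map ffin_map_linear.

End FiniteSupportMap.

Arguments ffin_map {A} Z {V W} g f.

Section TensorProduct.
Context {A : comPzRingType}.

Lemma free_gen_subproof (Z : choiceType) (z : Z) :
  (fun y => (y == z)%:R : A) \in fin_supp Z (regmod A).
Proof.
apply/asboolP; apply: (sub_finite_set _ (finite_set1 z)) => y /=.
by have [->//|_] := eqVneq y z; rewrite eqxx.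
Qed.

(* Ffin Z (regmod A) is the free module on Z, with basis (free_gen z)_z. *)
Definition free_gen (Z : choiceType) (z : Z) : Ffin Z (regmod A) :=
  MkFfin (free_gen_subproof z).

Definition free_lift (Z : choiceType) (V : lmodType A) (h : Z -> V)
  (f : Ffin Z (regmod A)) : V := \sum_(z \in [set: Z]) (f z : A) *: h z.

Lemma free_liftE (Z : choiceType) (V : lmodType A) (h : Z -> V)
    (f : Ffin Z (regmod A)) (B : set Z) : finite_set B ->
  [set z | f z != 0] `<=` B -> free_lift h f = \sum_(z \in B) (f z : A) *: h z.
Proof.
move=> finB fB; apply/esym/fsbig_widen => // z [_ /= Bz].
suff -> : f z = 0 by rewrite scale0r.
by apply/eqP/contraT => fz; exfalso; apply: Bz; exact: fB.
Qed.

Lemma free_lift_linear (Z : choiceType) (V : lmodType A) (h : Z -> V) :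
  linear (free_lift h).
Proof.
move=> r f g; pose B := [set z | f z != 0] `|` [set z | g z != 0].
have finB : finite_set B by rewrite finite_setU; split; exact: ffinP.
rewrite !(@free_liftE _ _ _ _ B) //.
- rewrite !fsbig_finite //= scaler_sumr -big_split /=.
  by apply: eq_bigr => z _; rewrite scalerA -scalerDl.
- by move=> z; right.
- by move=> z; left.
- move=> z; rewrite /mkset ffin_linearE.
  have [fz|] := eqVneq (f z) 0; last by left.
  by rewrite fz scaler0 add0r; right.
Qed.

HB.instance Definition _ (Z : choiceType) (V : lmodType A) (h : Z -> V) :=
  GRing.isLinear.Build A (Ffin Z (regmod A)) V *:%R (free_lift h)
    (free_lift_linear h).

Lemma free_lift_gen (Z : choiceType) (V : lmodType A) (h : Z -> V) z :
  free_lift h (free_gen z) = h z.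
Proof.
rewrite (@free_liftE _ _ _ _ [set z]) //; last first.
  by move=> y /=; have [->//|_] := eqVneq y z; rewrite eqxx.
by rewrite fsbig_set1 /= eqxx scale1r.
Qed.

Lemma ffin_sumE (Z : Type) (V : lmodType A) (I : Type) (s : seq I)
    (F : I -> Ffin Z V) z :
  (\sum_(i <- s) F i) z = \sum_(i <- s) F i z.
Proof. by elim/big_rec2: _ => // i y f _ <-. Qed.

Lemma free_genE (Z : choiceType) (f : Ffin Z (regmod A)) :
  exists s : seq Z, f = \sum_(z <- s) (f z : A) *: free_gen z.
Proof.
have /finite_seqP[s fs] := ffinP f; exists (undup s).
apply: ffin_eq => y; rewrite ffin_sumE.
have fE z : ((f z : A) *: free_gen z) y = f z * (y == z)%:R :> A by [].
under eq_bigr => z _ do rewrite fE.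
have [ys|ys] := boolP (y \in undup s); last first.
  rewrite big1_seq => [|z /= zs].
    apply: contraNeq ys => fy; rewrite mem_undup.
    by have : [set z | f z != 0] y by []; rewrite fs.
  by have [yz|_] := eqVneq y z; [rewrite yz zs in ys|rewrite mulr0].
rewrite (bigD1_seq y) ?undup_uniq //= eqxx mulr1 big1 ?addr0 // => z zy.
by rewrite eq_sym (negbTE zy) mulr0.
Qed.

Section Tensor.
Variables M N : lmodType A.

Definition tensor_rel : set (Ffin (M * N)%type (regmod A)) :=
  [set x | exists (m m' : M) (n : N),
     x = free_gen (m + m', n) - free_gen (m, n) - free_gen (m', n)] `|`
  [set x | exists (m : M) (n n' : N),
     x = free_gen (m, n + n') - free_gen (m, n) - free_gen (m, n')] `|`
  [set x | exists (r : A) (m : M) (n : N),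
     x = free_gen (r *: m, n) - r *: free_gen (m, n)] `|`
  [set x | exists (r : A) (m : M) (n : N),
     x = free_gen (m, r *: n) - r *: free_gen (m, n)].

Definition tensor : lmodType A := modquot (span tensor_rel).

Definition tens (m : M) (n : N) : tensor := mpi _ (free_gen (m, n)).

Definition bilin (P : lmodType A) (b : M -> N -> P) :=
  (forall n, linear (b^~ n)) /\ (forall m, linear (b m)).

Lemma tensor_rel_eq0 x : tensor_rel x -> mpi (span tensor_rel) x = 0.
Proof.
move=> relx; apply/eqP; rewrite -(linear0 (mpi (span tensor_rel))).
by rewrite mpi_eq subr0; exact: sub_span.
Qed.

Lemma tens_bilin : bilin tens.
Proof.
have Dl m m' n : tens (m + m') n = tens m n + tens m' n.
  apply/eqP; rewrite -subr_eq0 opprD addrA -!mpiB; apply/eqP/tensor_rel_eq0.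
  by left; left; left; exists m, m', n.
have Dr m n n' : tens m (n + n') = tens m n + tens m n'.
  apply/eqP; rewrite -subr_eq0 opprD addrA -!mpiB; apply/eqP/tensor_rel_eq0.
  by left; left; right; exists m, n, n'.
have Zl r m n : tens (r *: m) n = r *: tens m n.
  apply/eqP; rewrite -subr_eq0 -linearZ -mpiB; apply/eqP/tensor_rel_eq0.
  by left; right; exists r, m, n.
have Zr r m n : tens m (r *: n) = r *: tens m n.
  apply/eqP; rewrite -subr_eq0 -linearZ -mpiB; apply/eqP/tensor_rel_eq0.
  by right; exists r, m, n.
by split=> [n r m m'|m r n n']; rewrite ?Dl ?Dr ?Zl ?Zr.
Qed.

Lemma tensor_ext (P : lmodType A) (f g : {linear tensor -> P}) :
  (forall m n, f (tens m n) = g (tens m n)) -> f =1 g.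
Proof.
move=> fg x; rewrite -[x](mreprK (x : modquot _)).
have [s ->] := free_genE (mrepr (x : modquot _)).
rewrite !linear_sum; apply: eq_bigr => -[m n] _.
by rewrite linearZ !linearZ; congr (_ *: _); exact: fg.
Qed.

Section Lift.
Variables (P : lmodType A) (b : M -> N -> P).

(* Meaningful for b bilinear only: it is then independent of the representative *)
(* (see tensor_lift_mpi). *)
Definition tensor_lift (x : tensor) : P :=
  free_lift (fun p => b p.1 p.2) (mrepr (x : modquot (span tensor_rel))).

Hypothesis bP : bilin b.

Lemma free_lift_rel x : x \in span tensor_rel ->
  free_lift (fun p => b p.1 p.2) x = 0.
Proof.
move=> xS; apply/eqP; set h := fun p => _.
apply: (@span_sub _ _ tensor_rel [pred x | free_lift h x == 0]) xS => [|{}x].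
  split=> [|r y z]; rewrite !inE.
    by rewrite linear0.
  by move=> /eqP y0 /eqP z0; rewrite free_lift_linear y0 z0 scaler0 addr0.
have [bl br] := bP.
have blD n : {morph b^~ n : m m' / m + m'}.
  by move=> m m'; rewrite -[m]scale1r bl !scale1r.
have brD m : {morph b m : n n' / n + n'}.
  by move=> n n'; rewrite -[n]scale1r br !scale1r.
move=> [[[|]|]|] [m [m' [n ->]]]; rewrite inE !linearB /= ?linearZ /=.
- by rewrite !free_lift_gen /h /= blD -addrA -opprD subrr.
- by rewrite !free_lift_gen /h /= brD -addrA -opprD subrr.
- by rewrite !free_lift_gen /h /= (scalable_linear (bl _)) scalerN subrr.
- by rewrite !free_lift_gen /h /= (scalable_linear (br _)) scalerN subrr.
Qed.

Lemma tensor_lift_mpi x :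
  tensor_lift (mpi _ x) = free_lift (fun p => b p.1 p.2) x.
Proof.
apply/eqP; rewrite -subr_eq0 -linearB /=.
by apply/eqP/free_lift_rel/mrepr_mpi.
Qed.

Lemma tensor_lift_tens m n : tensor_lift (tens m n) = b m n.
Proof. by rewrite tensor_lift_mpi free_lift_gen. Qed.

Lemma tensor_lift_linear : linear tensor_lift.
Proof.
move=> r x y; rewrite -[x](mreprK (x : modquot _)) -[y](mreprK (y : modquot _)).
by rewrite -[in LHS]mpi_linear !tensor_lift_mpi free_lift_linear.
Qed.

End Lift.
End Tensor.

Definition tensor_map (M N M' N' : lmodType A) (f : M -> M') (g : N -> N') :
  tensor M N -> tensor M' N' := tensor_lift (fun m n => tens (f m) (g n)).

Section TensorMap.
Variables M N M' N' : lmodType A.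
Variables (f : {linear M -> M'}) (g : {linear N -> N'}).

Lemma tens_comp_bilin : bilin (fun m n => tens (f m) (g n)).
Proof.
have [bl br] := tens_bilin M' N'.
by split=> [n r m m'|m r n n']; rewrite linearP ?bl ?br.
Qed.

Lemma tensor_map_tens m n : tensor_map f g (tens m n) = tens (f m) (g n).
Proof. exact/tensor_lift_tens/tens_comp_bilin. Qed.

Lemma tensor_map_linear : linear (tensor_map f g).
Proof. exact/tensor_lift_linear/tens_comp_bilin. Qed.

HB.instance Definition _ := GRing.isLinear.Build A (tensor M N) (tensor M' N')
  *:%R (tensor_map f g) tensor_map_linear.

End TensorMap.

End TensorProduct.

Section AdicFiltration.
Context {A : comPzRingType}.

(* The submodule bN of N generated by the products of elements of b and N. *)
Definition ideal_smul (V : lmodType A) (b : {pred regmod A}) (N : {pred V}) :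
  {pred V} := span [set (r : A) *: v | r in [set` b] & v in [set` N]].

Variable a : ideal A.

Fixpoint ideal_pow (i : nat) : {pred regmod A} :=
  if i is j.+1 then ideal_smul a (ideal_pow j) else predT.

Lemma ideal_pow_submod i : submod_closed (ideal_pow i).
Proof. by case: i => [|i]; [|exact: span_submod]. Qed.

HB.instance Definition _ i :=
  GRing.isSubmodClosed.Build A (regmod A) (ideal_pow i) (ideal_pow_submod i).

Definition adic_sub (i : nat) (V : lmodType A) : {pred V} :=
  ideal_smul (ideal_pow i) predT.

Arguments adic_sub i V _ : clear implicits.

Lemma ideal_powS i : {subset ideal_pow i.+1 <= ideal_pow i}.
Proof.
apply: span_sub (ideal_pow_submod i) _ => _ [r _ [v iv <-]].
exact: rpredZ.
Qed.

Lemma adic_subS i V : {subset adic_sub i.+1 V <= adic_sub i V}.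
Proof.
apply: span_sub; first exact: span_submod.
move=> _ [r ir [v _ <-]]; apply: sub_span; exists r; last by exists v.
exact: ideal_powS.
Qed.

Lemma adic_sub_le i j V : (i <= j)%N ->
  {subset adic_sub j V <= adic_sub i V}.
Proof.
move=> /subnKC <-; elim: (j - i)%N => [|k IHk] v; first by rewrite addn0.
by rewrite addnS => /adic_subS /IHk.
Qed.

Lemma adic_sub0 V v : v \in adic_sub 0 V.
Proof. by apply: sub_span; exists 1 => //; exists v => //; exact: scale1r. Qed.

Lemma adic_sub_submod i V : submod_closed (adic_sub i V).
Proof. exact: span_submod. Qed.

HB.instance Definition _ i V :=
  GRing.isSubmodClosed.Build A V (adic_sub i V) (adic_sub_submod i V).

Lemma adic_sub_map i (V W : lmodType A) (g : {linear V -> W}) v :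
  v \in adic_sub i V -> g v \in adic_sub i W.
Proof.
apply: (@span_sub _ _ _ [pred x | g x \in adic_sub i W]).
  split=> [|r x y gx gy]; first by rewrite unfold_in /= linear0 rpred0.
  rewrite unfold_in /= linearP rpredD // rpredZ //; exact: gx.
move=> _ [r ir [w _ <-]]; rewrite unfold_in /= linearZ; apply: sub_span.
by exists r => //; exists (g w).
Qed.

(* ord takes values in N u {oo}, seen inside the extended rationals, where *)
(* ereal_sup is available; the set below always contains 0. *)
Definition adic_ord (V : lmodType A) (v : V) : \bar rat :=
  ereal_sup [set (j%:R : rat)%:E | j in [set j | v \in adic_sub j V]].

Lemma adic_ord_le (V : lmodType A) (v : V) (i : nat) :
  (adic_ord v <= i%:R%:E)%E <-> v \notin adic_sub i.+1 V.
Proof.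
set S := [set (j%:R : rat)%:E | j in [set j | v \in adic_sub j V]].
have ubS k : v \notin adic_sub k.+1 V -> ubound S (k%:R : rat)%:E.
  move=> vk _ [j /= vj <-]; rewrite lee_fin ler_nat leqNgt.
  by apply: contra vk => kj; exact: adic_sub_le vj.
split=> [vi|/ubS]; last exact: ge_ereal_sup.
apply/negP => vi1.
have [s supS] : supremums S !=set0.
  have [exv|/forallNP vall] := pselect (exists k, v \notin adic_sub k V).
    case: (ex_minnP exv) => -[|m] vm mmin.
      by rewrite adic_sub0 in vm.
    exists (m%:R : rat)%:E; split; first exact: ubS.
    move=> y; apply; exists m => //=.
    by apply: contraT => /mmin; rewrite ltnn.
  exists +oo%E; split=> [y _|y yS]; first by rewrite leey.
  have Sn n : ((n%:R : rat)%:E <= y)%E.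
    by apply: yS; exists n => //=; apply/negPn/negP; exact: vall.
  case: y {yS} Sn => [r|//|/(_ 0%N)//] /(_ (Num.truncn r).+1).
  by rewrite lee_fin leNgt truncnS_gt.
have := ge_supremum_Nmem -oo%E (ex_intro _ s supS)
  (ex_intro2 _ _ i.+1 vi1 erefl : S (i.+1%:R : rat)%:E).
by move=> /le_trans /(_ vi); rewrite lee_fin ler_nat ltnn.
Qed.

End AdicFiltration.

Arguments ideal_pow {A} a i _.
Arguments adic_sub {A} a i V _.

Section Decaying.
Context {A : comPzRingType}.
Variables (a : ideal A) (Z : Type) (V : lmodType A).

Definition decaying : {pred Z -> V} := fun f =>
  `[< forall i : nat, finite_set [set z | (adic_ord a (f z) <= i%:R%:E)%E] >].

Lemma decayingP (f : Z -> V) : reflect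
  (forall i : nat, finite_set [set z | f z \notin adic_sub a i.+1 V])
  (f \in decaying).
Proof.
apply: (iffP (asboolP _)) => fd i; apply: sub_finite_set (fd i) => z /=.
  by move/adic_ord_le.
by move/adic_ord_le.
Qed.

Lemma decaying_submod : submod_closed decaying.
Proof.
split=> [|r f g /decayingP fd /decayingP gd]; apply/decayingP => i.
  rewrite (_ : mkset _ = set0) //; apply/seteqP; split => z //=.
  by rewrite rpred0.
apply: (@sub_finite_set _ _ ([set z | f z \notin adic_sub a i.+1 V] `|`
  [set z | g z \notin adic_sub a i.+1 V])); last by rewrite finite_setU.
move=> z; rewrite /mkset -[(r *: f + g) z]/(r *: f z + g z) => fgz.
apply/orP; rewrite -negb_and; apply: contra fgz => /andP[fz gz].
by rewrite rpredD // rpredZ.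
Qed.

HB.instance Definition _ :=
  GRing.isSubmodClosed.Build A (Z -> V) decaying decaying_submod.

Record Fdec := MkFdec { fdec_fun :> Z -> V; _ : fdec_fun \in decaying }.

HB.instance Definition _ := [isSub for fdec_fun].
HB.instance Definition _ := [Choice of Fdec by <:].
HB.instance Definition _ := [SubChoice_isSubLmodule of Fdec by <:].

Lemma fdecP (f : Fdec) i :
  finite_set [set z | f z \notin adic_sub a i.+1 V].
Proof. exact/decayingP/(valP f). Qed.

Lemma fdec_eq (f g : Fdec) : (forall z, f z = g z) -> f = g.
Proof. by move=> fg; apply/val_inj/funext. Qed.

End Decaying.

Arguments decaying {A} a Z V.

Section DecayingMap.
Context {A : comPzRingType}.
Variables (a : ideal A) (Z : Type) (V W : lmodType A) (g : {linear V -> W}).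

Lemma fdec_map_subproof (f : Fdec a Z V) : (g \o f) \in decaying a Z W.
Proof.
apply/decayingP => i; apply: (sub_finite_set _ (fdecP f i)) => z /=.
by apply: contra; exact: adic_sub_map.
Qed.

Definition fdec_map (f : Fdec a Z V) : Fdec a Z W :=
  MkFdec (fdec_map_subproof f).

Lemma fdec_of_fin_subproof (f : Ffin Z V) : (g \o f) \in decaying a Z W.
Proof.
apply/decayingP => i; apply: (sub_finite_set _ (ffinP f)) => z /=.
by apply: contraNneq => ->; rewrite linear0 rpred0.
Qed.

Definition fdec_of_fin (f : Ffin Z V) : Fdec a Z W :=
  MkFdec (fdec_of_fin_subproof f).

Lemma fdec_map_linear : linear fdec_map.
Proof. by move=> r f h; apply: fdec_eq => z; rewrite /= linearP. Qed.

HB.instance Definition _ := GRing.isLinear.Build A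
  (Fdec a Z V) (Fdec a Z W) *:%R fdec_map fdec_map_linear.

Lemma fdec_of_fin_linear : linear fdec_of_fin.
Proof. by move=> r f h; apply: fdec_eq => z; rewrite /= linearP. Qed.

HB.instance Definition _ := GRing.isLinear.Build A
  (Ffin Z V) (Fdec a Z W) *:%R fdec_of_fin fdec_of_fin_linear.

End DecayingMap.

Arguments fdec_map {A} a Z {V W} g f.
Arguments fdec_of_fin {A} a Z {V W} g f.

Section SequenceModule.
Context {A : comPzRingType}.
Variable V : nat -> lmodType A.

Definition seqmod : Type := forall i, V i.

Lemma seqmod_eq (x y : seqmod) : (forall i, x i = y i) -> x = y.
Proof. exact: functional_extensionality_dep. Qed.

HB.instance Definition _ := gen_eqMixin seqmod.
HB.instance Definition _ := gen_choiceMixin seqmod.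

Definition seqmod_add (x y : seqmod) : seqmod := fun i => x i + y i.
Definition seqmod_opp (x : seqmod) : seqmod := fun i => - x i.
Definition seqmod_zero : seqmod := fun i => 0.
Definition seqmod_scale (r : A) (x : seqmod) : seqmod := fun i => r *: x i.

Lemma seqmod_addA : associative seqmod_add.
Proof. by move=> x y z; apply: seqmod_eq => i; exact: addrA. Qed.
Lemma seqmod_addC : commutative seqmod_add.
Proof. by move=> x y; apply: seqmod_eq => i; exact: addrC. Qed.
Lemma seqmod_add0 : left_id seqmod_zero seqmod_add.
Proof. by move=> x; apply: seqmod_eq => i; exact: add0r. Qed.
Lemma seqmod_addN : left_inverse seqmod_zero seqmod_opp seqmod_add.
Proof. by move=> x; apply: seqmod_eq => i; exact: addNr. Qed.

HB.instance Definition _ := GRing.isZmodule.Build seqmod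
  seqmod_addA seqmod_addC seqmod_add0 seqmod_addN.

Lemma seqmod_scaleA r s x :
  seqmod_scale r (seqmod_scale s x) = seqmod_scale (r * s) x.
Proof. by apply: seqmod_eq => i; exact: scalerA. Qed.
Lemma seqmod_scale1 : left_id 1 seqmod_scale.
Proof. by move=> x; apply: seqmod_eq => i; exact: scale1r. Qed.
Lemma seqmod_scaleDr : right_distributive seqmod_scale +%R.
Proof. by move=> r x y; apply: seqmod_eq => i; exact: scalerDr. Qed.
Lemma seqmod_scaleDl x : {morph seqmod_scale^~ x : r s / r + s}.
Proof. by move=> r s; apply: seqmod_eq => i; exact: scalerDl. Qed.

HB.instance Definition _ := GRing.Zmodule_isLmodule.Build A seqmod
  seqmod_scaleA seqmod_scale1 seqmod_scaleDr seqmod_scaleDl.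

End SequenceModule.

Section Completion.
Context {A : comPzRingType}.
Variable a : ideal A.

(* A_i = A / a^(i+1) *)
Definition adic_quot (i : nat) : lmodType A := modquot (ideal_pow a i.+1).

(* The projection A_(i+1) -> A_i. *)
Definition adic_trans (i : nat) (x : adic_quot i.+1) : adic_quot i :=
  mpi (ideal_pow a i.+1) (mrepr (x : modquot (ideal_pow a i.+2))).

Lemma adic_trans_mpi i (r : regmod A) :
  @adic_trans i (mpi (ideal_pow a i.+2) r) = mpi (ideal_pow a i.+1) r.
Proof. by apply/eqP; rewrite mpi_eq; apply/ideal_powS/mrepr_mpi. Qed.

Lemma adic_trans_linear i : linear (@adic_trans i).
Proof.
move=> r x y.
rewrite -[x](mreprK (x : modquot _)) -[y](mreprK (y : modquot _)).
by rewrite -[in LHS]mpi_linear !adic_trans_mpi mpi_linear.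
Qed.

HB.instance Definition _ i := GRing.isLinear.Build A
  (adic_quot i.+1) (adic_quot i) *:%R (@adic_trans i) (@adic_trans_linear i).

Definition adic_tensor (N : lmodType A) (i : nat) : lmodType A :=
  tensor (adic_quot i) N.

Section CompletionOf.
Variable N : lmodType A.

(* The inverse limit of the A_i (x) N, as the module of compatible sequences. *)
Definition compatible : {pred seqmod (adic_tensor N)} := fun x =>
  `[< forall i, tensor_map (@adic_trans i) (@idfun N) (x i.+1) = x i >].

Lemma compatible_submod : submod_closed compatible.
Proof.
split=> [|r x y /asboolP xc /asboolP yc]; apply/asboolP => i.
  exact: linear0.
rewrite -[RHS]/(r *: x i + y i) -xc -yc.
exact: tensor_map_linear.
Qed.

HB.instance Definition _ := GRing.isSubmodClosed.Build A
  (seqmod (adic_tensor N)) compatible compatible_submod.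

Record completion := MkCompletion {
  completion_val : seqmod (adic_tensor N);
  _ : completion_val \in compatible }.

HB.instance Definition _ := [isSub for completion_val].
HB.instance Definition _ := [Choice of completion by <:].
HB.instance Definition _ := [SubChoice_isSubLmodule of completion by <:].

Lemma completionP (x : completion) i :
  tensor_map (@adic_trans i) (@idfun N) (completion_val x i.+1) =
  completion_val x i.
Proof. by move: i; apply/asboolP/(valP x). Qed.

Lemma completion_eq (x y : completion) :
  (forall i, completion_val x i = completion_val y i) -> x = y.
Proof. by move=> xy; apply/val_inj/functional_extensionality_dep. Qed.

Definition adic_one (i : nat) : adic_quot i :=
  mpi (ideal_pow a i.+1) (1 : A).

Definition tau_seq (n : N) : seqmod (adic_tensor N) :=
  fun i => tens (adic_one i) n.

Lemma tau_seq_compatible n : tau_seq n \in compatible.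
Proof.
by apply/asboolP => i; rewrite /tau_seq tensor_map_tens /= adic_trans_mpi.
Qed.

Definition tau (n : N) : completion := MkCompletion (tau_seq_compatible n).

Lemma tau_linear : linear tau.
Proof.
move=> r m n; apply: completion_eq => i.
have [_ br] := tens_bilin (adic_quot i) N.
exact: br.
Qed.

HB.instance Definition _ :=
  GRing.isLinear.Build A N completion *:%R tau tau_linear.

Definition adic_complete : Prop := bijective tau.

End CompletionOf.

Arguments compatible N _ : clear implicits.

Section CompletionMap.
Variables (M N : lmodType A) (g : {linear M -> N}).

Definition completion_map_seq (x : completion M) : seqmod (adic_tensor N) :=
  fun i => tensor_map (@idfun (adic_quot i)) g (completion_val x i).

Lemma tensor_map_square i (x : adic_tensor M i.+1) :
  tensor_map (@adic_trans i) (@idfun N)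
    (tensor_map (@idfun (adic_quot i.+1)) g x) =
  tensor_map (@idfun (adic_quot i)) g
    (tensor_map (@adic_trans i) (@idfun M) x).
Proof.
pose f := tensor_map (@adic_trans i) (@idfun N) \o
  tensor_map (@idfun (adic_quot i.+1)) g.
pose h := tensor_map (@idfun (adic_quot i)) g \o
  tensor_map (@adic_trans i) (@idfun M).
by apply: (@tensor_ext _ _ _ _ f h) => m n; rewrite /= !tensor_map_tens.
Qed.

Lemma completion_map_compatible x : completion_map_seq x \in compatible N.
Proof.
apply/asboolP => i; rewrite /completion_map_seq -(completionP x i).
exact: tensor_map_square.
Qed.

Definition completion_map (x : completion M) : completion N :=
  MkCompletion (completion_map_compatible x).

Lemma completion_map_linear : linear completion_map.
Proof.
move=> r x y; apply: completion_eq => i.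
exact: (tensor_map_linear (@idfun (adic_quot i)) g).
Qed.

HB.instance Definition _ := GRing.isLinear.Build A
  (completion M) (completion N) *:%R completion_map completion_map_linear.

End CompletionMap.
End Completion.

Arguments completion {A} a N.
Arguments tau {A} a N n.
Arguments completion_map {A} a {M N} g x.
Arguments adic_complete {A} a N.

(* Main.v *)
Require Import Defs.
From HB Require Import structures.
From mathcomp Require Import all_boot all_order all_algebra.
From mathcomp Require Import all_classical.

Set Implicit Arguments.
Unset Strict Implicit.
Unset Printing Implicit Defensive.

Import GRing.Theory.
Local Open Scope ring_scope.

(** Write [M^] for the completion of [M] and [M_i] for the tensor product of
    [A / a^(i+1)] with [M], which is the quotient of [M] by [a^(i+1) M].

    Evaluation at a point [z] is a linear map from [Ffin Z M] to [M], and so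
    induces a linear map from the completion of [Ffin Z M] to [M^].  Collecting
    these maps over all [z] sends an element of that completion to a function
    from [Z] to [M^].  A finitely supported function lies in [a^(i+1) Ffin Z M]
    as soon as each of its values lies in [a^(i+1) M], being the finite sum of
    the functions concentrated at one point that carry its values; therefore an
    element of the completion is determined by its function
    ([completion_eval_inj]).  Which functions arise?  Exactly the functions [f]
    such that for each [i] only finitely many coordinates [(f z)_i] in [M_i]
    are nonzero: such coordinates lift to a finitely supported function with
    values in [M], and uniqueness makes these lifts compatible as [i] varies.

    It remains to compare this finiteness condition with decay, that is, to
    compare the kernel of the projection from [M^] to [M_i] with [a^(i+1) M^].
    The kernel always contains [a^(i+1) M^], because [a^(i+1)] kills [M_i]
    ([completion_val_adic_sub]), so every decaying function [f] comes from an
    element [dec_completion f].  The two are equal when [M^] is complete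
    ([adic_complete_coord0]), and this is what makes [dec_completion]
    surjective.  Linearity, functoriality and the compatibility with the maps
    from [Ffin Z M] are all checked after evaluation at each point, where they
    are immediate. *)

(** * Tensoring with a quotient of the ring *)

Section AdicTensor.
Context {A : comPzRingType} (a : ideal A).
Implicit Types (N : lmodType A) (i : nat).

Lemma tens_one_linear N i : linear (tens (adic_one a i) : N -> _).
Proof. by have [_] := tens_bilin (adic_quot a i) N; exact. Qed.

HB.instance Definition _ N i := GRing.isLinear.Build A N (adic_tensor a N i)
  *:%R (tens (adic_one a i)) (@tens_one_linear N i).

Lemma tensZl N i r (q : adic_quot a i) (n : N) :
  tens (r *: q) n = r *: tens q n.
Proof.
have [bl _] := tens_bilin (adic_quot a i) N.
exact: (scalable_linear (bl n)).
Qed.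

Lemma scale_adic_one i (r : A) :
  r *: adic_one a i = Defs.mpi (ideal_pow a i.+1) r.
Proof. by rewrite /adic_one -linearZ_LR /GRing.scale /= mulr1. Qed.

(** Moving scalars across the tensor product turns [(r mod a^(i+1)) (x) n]
    into [1 (x) (r n)], and sums of these have the same form. *)
Lemma tens_one_surj N i (x : adic_tensor a N i) :
  exists n : N, x = tens (adic_one a i) n.
Proof.
have tensE (q : adic_quot a i) (n : N) :
    tens q n = tens (adic_one a i) ((mrepr (q : modquot _) : A) *: n).
  rewrite linearZ /= -tensZl; congr (tens _ n).
  by rewrite scale_adic_one (mreprK (q : modquot _)).
rewrite -[x](mreprK (x : modquot _)).
have [s ->] := free_genE (mrepr (x : modquot _)).
rewrite linear_sum.
exists (\sum_(z <- s) (mrepr (x : modquot _) z : A) *: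
  ((mrepr (z.1 : modquot _) : A) *: z.2)).
rewrite linear_sum; apply: eq_bigr => -[q n] _.
by rewrite linearZ_LR /= linearZ_LR /= -tensE.
Qed.

Lemma scale_adic_sub N i (r : A) (n : N) :
  r \in ideal_pow a i -> r *: n \in adic_sub a i N.
Proof.
by move=> ir; apply: Defs.sub_span; exists r => //; exists n.
Qed.

(** One half of the identification of [A / a^(i+1)] tensored with [N] with the
    quotient of [N] by [a^(i+1) N]: the map to the quotient is induced by the
    bilinear map [(r mod a^(i+1), n) |-> r n mod a^(i+1) N]. *)
Lemma adic_sub_of_tens N i (n : N) :
  tens (adic_one a i) n = 0 -> n \in adic_sub a i.+1 N.
Proof.
pose b (q : adic_quot a i) (n : N) : modquot (adic_sub a i.+1 N) :=
  Defs.mpi (adic_sub a i.+1 N) ((mrepr (q : modquot _) : A) *: n).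
have bE (r : A) m :
    b (Defs.mpi (ideal_pow a i.+1) r) m = Defs.mpi (adic_sub a i.+1 N) (r *: m).
  apply/eqP; rewrite mpi_eq -scalerBl.
  exact/scale_adic_sub/(@mrepr_mpi _ _ (ideal_pow a i.+1)).
have bP : bilin b.
  split=> [m r p q|q r m m'].
    rewrite -[p](mreprK (p : modquot _)) -[q](mreprK (q : modquot _)).
    by rewrite -linearP !bE -linearP scalerDl -scalerA.
  by rewrite /b -linearP scalerDr !scalerA mulrC.
move=> /(congr1 (tensor_lift b)); rewrite tensor_lift_tens // bE scale1r.
have -> : tensor_lift b 0 = 0.
  have := tensor_lift_linear bP (-1) 0 0.
  by rewrite scaler0 addr0 scaleN1r addNr.
by move/eqP; rewrite -(linear0 (Defs.mpi (adic_sub a i.+1 N))) mpi_eq subr0.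
Qed.

Lemma adic_sub_killed i (V W : lmodType A) (g : {linear V -> W}) v :
  (forall (r : A) w, r \in ideal_pow a i -> r *: g w = 0) ->
  v \in adic_sub a i V -> g v = 0.
Proof.
move=> g0 vV; apply/eqP.
apply: (@Defs.span_sub _ _ _ [pred w | g w == 0]) vV.
  split=> [|r w w' /eqP gw /eqP gw']; apply/eqP; first exact: linear0.
  by rewrite linearP gw gw' scaler0 addr0.
by move=> _ [r ir [w _ <-]]; apply/eqP; rewrite linearZ /= g0.
Qed.

Lemma tens_of_adic_sub N i (n : N) :
  n \in adic_sub a i.+1 N -> tens (adic_one a i) n = 0.
Proof.
apply: adic_sub_killed => r m ir; rewrite /= -tensZl.
suff -> : r *: adic_one a i = 0 by rewrite -(scale0r 0) tensZl scale0r.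
apply/eqP; rewrite scale_adic_one -(linear0 (Defs.mpi (ideal_pow a i.+1))).
by rewrite mpi_eq subr0.
Qed.

Lemma adic_tensor_killed N i (x : adic_tensor a N i) :
  x \in adic_sub a i.+1 (adic_tensor a N i) -> x = 0.
Proof.
apply: (@adic_sub_killed _ _ _ idfun) => r y ir /=.
have [n ->] := tens_one_surj y; rewrite -linearZ /=.
exact/tens_of_adic_sub/scale_adic_sub.
Qed.

End AdicTensor.

(** * Coordinates of a completion *)

Section CompletionCoordinates.
Context {A : comPzRingType} (a : ideal A) (M : lmodType A).

Definition completion_coord i (x : completion a M) : adic_tensor a M i :=
  completion_val x i.

Lemma completion_coord_linear i : linear (completion_coord i).
Proof. by []. Qed.

HB.instance Definition _ i := GRing.isLinear.Build A (completion a M)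
  (adic_tensor a M i) *:%R (completion_coord i) (@completion_coord_linear i).

Lemma completion_val_adic_sub i (x : completion a M) :
  x \in adic_sub a i.+1 (completion a M) -> completion_val x i = 0.
Proof.
by move=> /(adic_sub_map (completion_coord i)); exact: adic_tensor_killed.
Qed.

(** Both [tau] of the completion and the completion of [tau] embed [M^] into
    its own completion.  They agree once the former is surjective: if
    [completion_map tau x = tau w], then [w] is congruent modulo [a^(i+1) M^]
    to the image of any lift of [x_i] to [M], whence [w_i = x_i]. *)
Lemma completion_map_tau (x : completion a M) :
  adic_complete a (completion a M) ->
  completion_map a (tau a M) x = tau a (completion a M) x.
Proof.
case=> t _ tauK; set y := completion_map _ _ _.
rewrite -[LHS]tauK; congr (tau _ _ _); apply: completion_eq => i.
have [m xi] := tens_one_surj (completion_val x i).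
have yi : completion_val y i = tens (adic_one a i) (tau a M m).
  by rewrite /y /= /completion_map_seq xi tensor_map_tens.
have wi : completion_val (tau a _ (t y)) i = completion_val y i by rewrite tauK.
rewrite xi -[RHS]/(completion_coord i (tau a M m)); apply/eqP.
rewrite -subr_eq0 -[completion_val _ i]/(completion_coord i (t y)) -linearB.
apply/eqP/completion_val_adic_sub/adic_sub_of_tens.
by rewrite linearB /= -yi -wi subrr.
Qed.

(** Without completeness the kernel of a coordinate can be larger than
    [a^(i+1) M^] when the ideal is not finitely generated.  Here the class of
    [x] modulo [a^(i+1) M^] is a coordinate of [tau x], equivalently of
    [completion_map tau x], and thus depends only on [x_i]. *)
Lemma adic_complete_coord0 i (x : completion a M) :
  adic_complete a (completion a M) -> completion_val x i = 0 ->
  x \in adic_sub a i.+1 (completion a M).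
Proof.
move=> /(completion_map_tau x) tx xi; apply: adic_sub_of_tens.
rewrite -[LHS]/(completion_val (tau a _ x) i) -tx /= /completion_map_seq xi.
exact: linear0.
Qed.

Lemma completion_map_tauE (N : lmodType A) (g : {linear M -> N}) m :
  completion_map a g (tau a M m) = tau a N (g m).
Proof. by apply: completion_eq => i; exact: tensor_map_tens. Qed.

End CompletionCoordinates.

Lemma completion_map_comp (A : comPzRingType) (a : ideal A)
    (M N P : lmodType A) (g : {linear M -> N}) (h : {linear N -> P})
    (k : {linear M -> P}) x : (forall m, h (g m) = k m) ->
  completion_map a h (completion_map a g x) = completion_map a k x.
Proof.
move=> hg; apply: completion_eq => i; rewrite /= /completion_map_seq /=.
rewrite /completion_map_seq.
have [m ->] := tens_one_surj (completion_val x i).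
by rewrite !tensor_map_tens /= hg.
Qed.

(** * Evaluation of finitely supported functions *)

Section Evaluation.
Context {A : comPzRingType} (Z : Type).

Definition ffin_eval (V : lmodType A) (z : Z) (h : Ffin Z V) : V := h z.

Lemma ffin_eval_linear V z : linear (@ffin_eval V z).
Proof. by []. Qed.

HB.instance Definition _ V z := GRing.isLinear.Build A (Ffin Z V) V *:%R
  (@ffin_eval V z) (@ffin_eval_linear V z).

Section Single.
Variables (V : lmodType A) (z : Z).

Lemma ffin_single_subproof (v : V) :
  (fun y => if `[< y = z >] then v else 0) \in fin_supp Z V.
Proof.
apply/asboolP; apply: (sub_finite_set _ (finite_set1 z)) => y /=.
by case: asboolP => // _; rewrite eqxx.
Qed.

Definition ffin_single (v : V) : Ffin Z V := MkFfin (ffin_single_subproof v).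

Lemma ffin_single_linear : linear ffin_single.
Proof.
move=> r v w; apply: ffin_eq => y; rewrite ffin_linearE /=.
by case: asboolP; rewrite // scaler0 addr0.
Qed.

HB.instance Definition _ := GRing.isLinear.Build A V (Ffin Z V) *:%R
  ffin_single ffin_single_linear.

End Single.

(** Indexing by [{classic Z}] equips the points with a decidable equality, which
    is what lets duplicates be removed from an enumeration of the support. *)
Lemma ffin_singleE (V : lmodType A) (h : Ffin Z V) :
  exists s : seq {classic Z}, h = \sum_(z <- s) ffin_single z (h z).
Proof.
have /(@finite_seqP {classic Z})[s hs] := ffinP h.
exists (undup s); apply: ffin_eq => y; rewrite ffin_sumE /=.
have [ys|ys] := boolP ((y : {classic Z}) \in undup s); last first.
  rewrite big1_seq => [|z /= zs].
    apply: contraNeq ys => hy; rewrite mem_undup.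
    by have : [set z | h z != 0]%classic y by []; rewrite hs.
  by case: asboolP => // yz; rewrite yz zs in ys.
rewrite (bigD1_seq (y : {classic Z})) ?undup_uniq //=.
rewrite big1 ?addr0 => [|z /eqP zy]; first by case: asboolP.
by case: asboolP => // yz; case: zy.
Qed.

Lemma ffin_adic_sub (a : ideal A) i (V : lmodType A) (h : Ffin Z V) :
  (forall z, h z \in adic_sub a i V) -> h \in adic_sub a i (Ffin Z V).
Proof.
move=> hV; have [s ->] := ffin_singleE h; apply: rpred_sum => z _.
exact: (adic_sub_map (ffin_single z)).
Qed.

(** A tensor in [A / a^(i+1)] with [Ffin Z V] is the class of a finitely
    supported function, and this class vanishes as soon as the values of the
    function lie in [a^(i+1) V]. *)
Lemma tensor_eval_inj (a : ideal A) i (V : lmodType A)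
    (x y : adic_tensor a (Ffin Z V) i) :
  (forall z, tensor_map (@idfun (adic_quot a i)) (@ffin_eval V z) x =
             tensor_map (@idfun (adic_quot a i)) (@ffin_eval V z) y) -> x = y.
Proof.
have [h ->] := tens_one_surj x; have [k ->] := tens_one_surj y => hk.
apply/eqP; rewrite -subr_eq0 -linearB; apply/eqP/tens_of_adic_sub.
apply: ffin_adic_sub => z; apply: adic_sub_of_tens.
rewrite -[(h - k) z]/(h z - k z) linearB.
by have := hk z; rewrite !tensor_map_tens /= => ->; rewrite subrr.
Qed.

Lemma completion_eval_inj (a : ideal A) (V : lmodType A)
    (x y : completion a (Ffin Z V)) :
  (forall z, completion_map a (@ffin_eval V z) x =
             completion_map a (@ffin_eval V z) y) -> x = y.
Proof.
move=> xy; apply: completion_eq => i; apply: tensor_eval_inj => z.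
exact: (congr1 (fun u => completion_val u i) (xy z)).
Qed.

End Evaluation.

(** * From decaying functions to the completion *)

Section DecCompletion.
Context {A : comPzRingType} (a : ideal A) (Z : Type) (M : lmodType A).
Implicit Types f : Fdec a Z (completion a M).

(** Only finitely many [(f z)_i] are nonzero, because [(f z)_i] vanishes when
    [f z] lies in [a^(i+1) M^]; choosing [0] as the lift of [0] then keeps the
    support finite. *)
Lemma dec_coord_lift f i : exists h : Ffin Z M,
  forall z, tens (adic_one a i) (h z) = completion_val (f z) i.
Proof.
have lift z : {m : M | tens (adic_one a i) m = completion_val (f z) i /\
    (completion_val (f z) i = 0 -> m = 0)}.
  apply: cid; have [->|nz] := eqVneq (completion_val (f z) i) 0.
    by exists 0; rewrite linear0.
  have [m mE] := tens_one_surj (completion_val (f z) i); exists m.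
  by split=> // z0; rewrite z0 eqxx in nz.
have fin : (fun z => sval (lift z)) \in fin_supp Z M.
  apply/asboolP; apply: sub_finite_set (fdecP f i) => z /=.
  apply: contraNN => /completion_val_adic_sub fz; apply/eqP.
  exact: (svalP (lift z)).2.
by exists (MkFfin fin) => z; exact: (svalP (lift z)).1.
Qed.

(** The lifts for different [i] are chosen independently, so that those for
    [i+1] and [i] can differ in [Ffin Z M]; they agree modulo [a^(i+1)] because
    evaluation at the points of [Z] is jointly injective there. *)
Lemma dec_completion_ex f : exists x : completion a (Ffin Z M),
  forall z, completion_map a (ffin_eval z) x = f z.
Proof.
have [h hE] := choice (dec_coord_lift f).
pose x : seqmod (adic_tensor a (Ffin Z M)) :=
  fun i => tens (adic_one a i) (h i).
have xc : x \in @compatible A a (Ffin Z M).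
  apply/asboolP => i; apply: tensor_eval_inj => z.
  rewrite -tensor_map_square /x !tensor_map_tens /=.
  by rewrite /ffin_eval hE -(completionP (f z)) -hE tensor_map_tens.
exists (MkCompletion xc) => z; apply: completion_eq => i /=.
by rewrite /completion_map_seq /= tensor_map_tens -hE.
Qed.

Definition dec_completion f : completion a (Ffin Z M) :=
  sval (cid (dec_completion_ex f)).

Lemma dec_completionE f z :
  completion_map a (ffin_eval z) (dec_completion f) = f z.
Proof. exact: (svalP (cid (dec_completion_ex f))). Qed.

Lemma dec_completion_linear : linear dec_completion.
Proof.
move=> r f g; apply: completion_eval_inj => z.
by rewrite linearP /= !dec_completionE.
Qed.

HB.instance Definition _ := GRing.isLinear.Build A
  (Fdec a Z (completion a M)) (completion a (Ffin Z M)) *:%R dec_completion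
  dec_completion_linear.

Lemma dec_completion_inj : injective dec_completion.
Proof.
by move=> f g fg; apply: fdec_eq => z; rewrite -!dec_completionE fg.
Qed.

(** The support of a lift of [x_i] contains all [z] at which the [i]-th
    coordinate is nonzero, and completeness puts every value whose [i]-th
    coordinate vanishes into [a^(i+1) M^]. *)
Lemma completion_eval_decaying (x : completion a (Ffin Z M)) :
  adic_complete a (completion a M) ->
  (fun z => completion_map a (ffin_eval z) x)
    \in decaying a Z (completion a M).
Proof.
move=> cM; apply/decayingP => i.
have [h xi] := tens_one_surj (completion_val x i).
apply: sub_finite_set (ffinP h) => z /=; apply: contraNneq => hz.
apply: adic_complete_coord0 => //=.
by rewrite /completion_map_seq xi tensor_map_tens /= /ffin_eval hz linear0.
Qed.

Lemma dec_completion_bij :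
  adic_complete a (completion a M) -> bijective dec_completion.
Proof.
move=> cM; pose g x := MkFdec (completion_eval_decaying x cM).
have gK : cancel g dec_completion.
  by move=> x; apply: completion_eval_inj => z; rewrite dec_completionE.
by exists g => // f; apply: dec_completion_inj; rewrite gK.
Qed.

Lemma dec_completion_fin (h : Ffin Z M) :
  dec_completion (fdec_of_fin a Z (tau a M) h) = tau a (Ffin Z M) h.
Proof.
apply: completion_eval_inj => z.
by rewrite dec_completionE completion_map_tauE.
Qed.

End DecCompletion.

Lemma dec_completion_natural (A : comPzRingType) (a : ideal A) (Z : Type)
    (M N : lmodType A) (g : {linear M -> N})
    (f : Fdec a Z (completion a M)) :
  dec_completion (fdec_map a Z (completion_map a g) f) =
  completion_map a (ffin_map Z g) (dec_completion f).
Proof.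
apply: completion_eval_inj => z; rewrite dec_completionE /=.
(* Applying g before or after evaluating at z gives the same map. *)
pose gz : {linear Ffin Z M -> N} := g \o ffin_eval z.
by rewrite -dec_completionE !(@completion_map_comp _ _ _ _ _ _ _ gz).
Qed.

Theorem corollary2p9 (A : comPzRingType) (a : ideal A) (Z : Type) :
  exists Phi : forall M : lmodType A, adic_complete a (completion a M) ->
      {linear Fdec a Z (completion a M) -> completion a (Ffin Z M)},
    (forall (M : lmodType A) (cM : adic_complete a (completion a M)),
       bijective (Phi M cM) /\
       forall f : Ffin Z M,
         Phi M cM (fdec_of_fin a Z (tau a M) f) = tau a (Ffin Z M) f) /\
    (forall (M N : lmodType A)
       (cM : adic_complete a (completion a M))
       (cN : adic_complete a (completion a N))
       (g : {linear M -> N}) (f : Fdec a Z (completion a M)),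
       Phi N cN (fdec_map a Z (completion_map a g) f) =
       completion_map a (ffin_map Z g) (Phi M cM f)).
Proof.
exists (fun M _ => @dec_completion A a Z M); split=> [M cM|M N _ _ g f].
  by split; [exact: dec_completion_bij|exact: dec_completion_fin].
exact: dec_completion_natural.
Qed.
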